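(* Let $\triangle P_1P_2P_3$ be a (closed, filled) triangle in $D$ with $\rho(\psi_{\triangle P_1P_2P_3})=\frac{2}{5}$. Then the number of periodic orbits of $\psi_{\triangle P_1P_2P_3}$ of period $5$ is at most $6$.
   Context: $D$ is the open unit disk in $\mathbb R^2$ and $S^1$ its boundary circle, identified with $\mathbb R/\mathbb Z$ via the counterclockwise normalized angle. For a closed convex set $U\subset D$ and $v\in S^1$, $\psi_U(v)$ is the point $w\in S^1\setminus\{v\}$ such that the line $vw$ meets $U$ and $U$ lies in the closed half-plane to the left of the directed line from $v$ to $w$ (the first point counterclockwise from $v$ whose chord from $v$ is tangent to $U$). $\psi_U$ is an orientation-preserving homeomorphism of $S^1$. For an orientation-preserving homeomorphism $f$ of $S^1$, $\rho(f)=\lim_{n\to\infty}(\overline f^n(x)-x)/n$ where $\overline f$ is the lift of $f$ to $\mathbb R$ with $\overline f(0)\in[0,1)$. *)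

(* Defs.v *)
From Stdlib Require Import Reals List ClassicalEpsilon.
Open Scope R_scope.

Definition pt := (R * R)%type.

Definition in_D (p : pt) : Prop := fst p * fst p + snd p * snd p < 1.
Definition on_S1 (p : pt) : Prop := fst p * fst p + snd p * snd p = 1.

(* cross product of (b - a) and (c - a): > 0 iff c is strictly to the left
   of the directed line from a to b *)
Definition cross3 (a b c : pt) : R :=
  (fst b - fst a) * (snd c - snd a) - (snd b - snd a) * (fst c - fst a).

Definition filled_triangle (P1 P2 P3 : pt) : pt -> Prop := fun p =>
  exists a b c : R, 0 <= a /\ 0 <= b /\ 0 <= c /\ a + b + c = 1 /\
    fst p = a * fst P1 + b * fst P2 + c * fst P3 /\
    snd p = a * snd P1 + b * snd P2 + c * snd P3.

(* psi_U(v) = w : w in S^1 \ {v}, the line vw meets U, and U lies in the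
   closed half-plane to the left of the directed line v -> w *)
Definition psi_rel (U : pt -> Prop) (v w : pt) : Prop :=
  on_S1 w /\ w <> v /\
  (exists p, U p /\ cross3 v w p = 0) /\
  (forall p, U p -> 0 <= cross3 v w p).

Definition psi (U : pt -> Prop) (v : pt) : pt :=
  epsilon (inhabits v) (fun w => psi_rel U v w).

Definition e (t : R) : pt := (cos (2 * PI * t), sin (2 * PI * t)).

Definition is_lift (f : pt -> pt) (F : R -> R) : Prop :=
  continuity F /\ (forall t, e (F t) = f (e t)) /\ 0 <= F 0 < 1.

Definition rot_number (f : pt -> pt) (r : R) : Prop :=
  exists F, is_lift f F /\
    forall x, Un_cv (fun n => (Nat.iter n F x - x) / INR n) r.

Definition periodic_pt (f : pt -> pt) (n : nat) (v : pt) : Prop :=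
  on_S1 v /\ Nat.iter n f v = v /\
  (forall k, (0 < k < n)%nat -> Nat.iter k f v <> v).

Definition same_orbit (f : pt -> pt) (u v : pt) : Prop :=
  exists k : nat, Nat.iter k f u = v.

(* Main.v *)
(** A lift F of psi satisfies t < F t < t + 1, and a period-5 orbit of rotation
    number 2/5 is a pentagram whose chords each touch a vertex of the triangle.
    Two consecutive chords cannot touch the same vertex (the orbit would have
    period 2), and three consecutive chords touching distinct vertices meet them
    in counterclockwise order, since each vertex maximizes the outer normal
    direction of its chord and these three directions positively span the plane.
    Hence, up to cyclic rotation, the word of vertices is C A B A B with C, A, B
    counterclockwise, which leaves three words. In half-angle coordinates the
    chord involution at a vertex is a linear map of trace zero, so the starting
    points for one word are the eigendirections of a 2x2 matrix: at most two of
    them, unless the matrix is scalar. If it were scalar, (H_B H_A)^2 would be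
    proportional to H_C and so have trace zero; but that trace is
    4 (1 - A.B)^2 - 2 (1 - |A|^2) (1 - |B|^2) > 0. *)

Require Import Defs.
From Stdlib Require Import Reals List.
From Stdlib Require Import ClassicalEpsilon Lra Lia.
Open Scope R_scope.

(** * The circle in half-angle coordinates *)

Lemma sqr_cos_sin (a : R) : cos a * cos a + sin a * sin a = 1.
Proof. pose proof (sin2_cos2 a) as H; unfold Rsqr in H; lra. Qed.

Lemma e_half (x : R) :
  e x = (cos (PI * x) * cos (PI * x) - sin (PI * x) * sin (PI * x),
         2 * sin (PI * x) * cos (PI * x)).
Proof.
unfold e; replace (2 * PI * x) with (2 * (PI * x)) by ring.
now rewrite cos_2a, sin_2a.
Qed.

Lemma on_S1_e (x : R) : on_S1 (e x).
Proof. unfold on_S1, e; simpl; apply sqr_cos_sin. Qed.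

Lemma on_S1_angle (v : pt) : on_S1 v -> exists x, v = e x.
Proof.
destruct v as [a b]; unfold on_S1, e; simpl; intros H.
assert (Ha : -1 <= a <= 1) by nra.
pose proof PI_RGT_0 as HPI.
assert (Hsq : 1 - a² = b²) by (unfold Rsqr; lra).
destruct (Rle_dec 0 b) as [Hb | Hb].
- exists (acos a / (2 * PI)).
  replace (2 * PI * (acos a / (2 * PI))) with (acos a) by (field; lra).
  rewrite cos_acos, sin_acos, Hsq, sqrt_Rsqr; trivial; lra.
- exists (- acos a / (2 * PI)).
  replace (2 * PI * (- acos a / (2 * PI))) with (- acos a) by (field; lra).
  rewrite cos_neg, sin_neg, cos_acos, sin_acos, Hsq, Rsqr_neg, sqrt_Rsqr;
    trivial; try lra.
  f_equal; ring.
Qed.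

Lemma sin_PI_IZR (k : Z) : sin (PI * IZR k) = 0.
Proof. apply sin_eq_0_1; exists k; ring. Qed.

Lemma sin_PI_eq_0 (x : R) : sin (PI * x) = 0 -> exists k : Z, x = IZR k.
Proof.
intros H; destruct (sin_eq_0_0 _ H) as [k Hk].
exists k; apply (Rmult_eq_reg_l PI); [lra | apply PI_neq0].
Qed.

(** The inner product of the two unit vectors is 1 minus twice the square of this sine. The sine is
    also the determinant of the two half-angle vectors. *)
Lemma e_eq_sin (x y : R) : e x = e y <-> sin (PI * (y - x)) = 0.
Proof.
unfold e.
pose proof (sqr_cos_sin (2 * PI * x)) as Hx.
pose proof (sqr_cos_sin (2 * PI * y)) as Hy.
assert (Hd : cos (2 * PI * x) * cos (2 * PI * y)
             + sin (2 * PI * x) * sin (2 * PI * y)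
             = 1 - 2 * sin (PI * (y - x)) * sin (PI * (y - x))).
{ rewrite <- cos_2a_sin.
  replace (2 * (PI * (y - x))) with (2 * PI * y - 2 * PI * x) by ring.
  rewrite cos_minus; ring. }
split.
- intros H; injection H as H1 H2; rewrite H1, H2 in Hd.
  apply Rsqr_0_uniq; unfold Rsqr; lra.
- intros H; rewrite H in Hd.
  destruct (Rplus_sqr_eq_0 (cos (2 * PI * x) - cos (2 * PI * y))
              (sin (2 * PI * x) - sin (2 * PI * y))) as [E1 E2].
  + unfold Rsqr; lra.
  + f_equal; lra.
Qed.

Lemma e_eq (x y : R) : e x = e y <-> exists k : Z, y = x + IZR k.
Proof.
rewrite e_eq_sin; split.
- intros H; destruct (sin_PI_eq_0 _ H) as [k Hk]; exists k; lra.
- intros [k ->]; replace (x + IZR k - x) with (IZR k) by ring.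
  apply sin_PI_IZR.
Qed.

Lemma sin_PI_pos (x : R) : 0 < x < 1 -> 0 < sin (PI * x).
Proof. intros H; pose proof PI_RGT_0; apply sin_gt_0; nra. Qed.

Lemma sin_PI_nonneg_lt2 (x : R) : 0 < x < 2 -> 0 <= sin (PI * x) -> x <= 1.
Proof.
intros H Hs; destruct (Rle_dec x 1) as [| Hx]; trivial.
pose proof PI_RGT_0.
assert (sin (PI * x) < 0) by (apply sin_lt_0; nra); lra.
Qed.

(** * The bilinear form of chords through a point *)

(* In the half-angle coordinates (cos (PI x), sin (PI x)) of the circle, the
   condition that P lies on the chord from [e x] to [e y] is bilinear. *)
Definition chord_form (P : pt) (x y : R) : R :=
  (1 - fst P) * (cos (PI * x) * cos (PI * y))
  + (1 + fst P) * (sin (PI * x) * sin (PI * y))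
  - snd P * (sin (PI * x) * cos (PI * y) + cos (PI * x) * sin (PI * y)).

(** The sine carries the antisymmetry in the two ends and leaves a symmetric bilinear form. For
    [0 < y - x < 1] both sides have the sign of [chord_form]. *)
Lemma cross3_chord_form (P : pt) (x y : R) :
  cross3 (e x) (e y) P = 2 * sin (PI * (y - x)) * chord_form P x y.
Proof.
rewrite Rmult_minus_distr_l, sin_minus.
unfold cross3, chord_form; rewrite !e_half; destruct P as [p q]; simpl.
pose proof (sqr_cos_sin (PI * x)) as Hx.
pose proof (sqr_cos_sin (PI * y)) as Hy.
set (c := cos (PI * x)) in *; set (s := sin (PI * x)) in *.
set (C := cos (PI * y)) in *; set (S := sin (PI * y)) in *.
(* The identity holds only modulo the relations [Hx] and [Hy], so factors equal to 1 are inserted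
   first to make it homogeneous. *)
transitivity (q * ((C * C - S * S) * (c * c + s * s)
                   - (c * c - s * s) * (C * C + S * S))
  - p * (2 * S * C * (c * c + s * s) - 2 * s * c * (C * C + S * S))
  + ((c * c - s * s) * (2 * S * C) - (C * C - S * S) * (2 * s * c))).
- rewrite Hx, Hy; ring.
- ring.
Qed.

(** The normal form of the chord line: outer normal at angle [PI * (x + y)], signed distance
    [cos (PI * (y - x))] from the centre. *)
Lemma chord_form_angle (P : pt) (x y : R) :
  chord_form P x y = cos (PI * (y - x)) - fst P * cos (PI * (x + y))
                     - snd P * sin (PI * (x + y)).
Proof.
rewrite Rmult_minus_distr_l, Rmult_plus_distr_l, cos_minus, cos_plus, sin_plus.
unfold chord_form; ring.
Qed.

Lemma chord_form_self_pos (P : pt) (x : R) : in_D P -> 0 < chord_form P x x.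
Proof.
rewrite chord_form_angle; unfold in_D; intros H.
replace (PI * (x - x)) with 0 by ring; rewrite cos_0.
pose proof (sqr_cos_sin (PI * (x + x))).
set (c := cos _) in *; set (s := sin _) in *.
pose proof (Rle_0_sqr (fst P - c)); pose proof (Rle_0_sqr (snd P - s)).
unfold Rsqr in *; lra.
Qed.

(** The half-angle vectors of [x], [y], [z] lie in a plane and hence are linearly dependent, with
    sines as coefficients; [chord_form P y] is applied to that relation. *)
Lemma chord_form_next (P : pt) (x y z : R) : chord_form P x y = 0 ->
  sin (PI * (y - x)) * chord_form P y z
  = sin (PI * (z - x)) * chord_form P y y.
Proof.
intros H.
replace (sin (PI * (z - x)) * chord_form P y y) with
  (sin (PI * (z - x)) * chord_form P y y
   - sin (PI * (z - y)) * chord_form P x y) by (rewrite H; ring).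
rewrite !Rmult_minus_distr_l, !sin_minus; unfold chord_form; ring.
Qed.

(** Half-angle coordinates have period 2; a shift by 1 reverses their sign. *)
Lemma cos_sin_PI_shift2 (x : R) :
  cos (PI * (x + 2)) = cos (PI * x) /\ sin (PI * (x + 2)) = sin (PI * x).
Proof.
replace (PI * (x + 2)) with (PI * x + 2 * PI) by ring.
now rewrite cos_plus, sin_plus, cos_2PI, sin_2PI; split; ring.
Qed.

Lemma chord_form_shift2 (P : pt) (x y : R) :
  chord_form P (x + 2) (y + 2) = chord_form P x y.
Proof.
unfold chord_form.
destruct (cos_sin_PI_shift2 x) as [-> ->].
now destruct (cos_sin_PI_shift2 y) as [-> ->].
Qed.

(** * Closed words have at most two solutions *)

(* The matrix of the involution exchanging the ends of chords through P. *)
Definition chord_flip (P v : pt) : pt :=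
  (snd P * fst v - (1 + fst P) * snd v, (1 - fst P) * fst v - snd P * snd v).

(** [chord_form P x y] is the determinant of the half-angle vector of [y] and the flipped vector of
    [x], so its vanishing makes them parallel. The factor [m] allows chaining. *)
Lemma chord_flip_form (P : pt) (x y m : R) : chord_form P x y = 0 ->
  exists m', chord_flip P (m * cos (PI * x), m * sin (PI * x))
             = (m' * cos (PI * y), m' * sin (PI * y)).
Proof.
intros H.
pose proof (sqr_cos_sin (PI * y)) as Hy.
unfold chord_form in H; unfold chord_flip; simpl.
set (c := cos (PI * x)) in *; set (s := sin (PI * x)) in *.
set (C := cos (PI * y)) in *; set (S := sin (PI * y)) in *.
set (u := snd P * (m * c) - (1 + fst P) * (m * s)).
set (w := (1 - fst P) * (m * c) - snd P * (m * s)).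
assert (Huw : C * w - S * u = 0).
{ transitivity (m * ((1 - fst P) * (c * C) + (1 + fst P) * (s * S)
                     - snd P * (s * C + c * S))).
  - unfold u, w; ring.
  - rewrite H; ring. }
exists (u * C + w * S); f_equal.
- replace u with (u * (C * C + S * S)) at 1 by (rewrite Hy; ring).
  replace (u * (C * C + S * S)) with
    ((u * C + w * S) * C - S * (C * w - S * u)) by ring.
  rewrite Huw; ring.
- replace w with (w * (C * C + S * S)) at 1 by (rewrite Hy; ring).
  replace (w * (C * C + S * S)) with
    ((u * C + w * S) * S + C * (C * w - S * u)) by ring.
  rewrite Huw; ring.
Qed.

(** The end is [x + 2] because a pentagram of rotation number 2/5 winds twice around the circle. *)
Definition closed_word (A B C : pt) (x : R) : Prop :=
  exists x1 x2 x3 x4,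
    chord_form C x x1 = 0 /\ chord_form A x1 x2 = 0 /\
    chord_form B x2 x3 = 0 /\ chord_form A x3 x4 = 0 /\
    chord_form B x4 (x + 2) = 0.

Definition word_map (A B C v : pt) : pt :=
  chord_flip B (chord_flip A (chord_flip B (chord_flip A (chord_flip C v)))).

Lemma word_map_linear (A B C : pt) (c s : R) :
  word_map A B C (c, s)
  = (c * fst (word_map A B C (1, 0)) + s * fst (word_map A B C (0, 1)),
     c * snd (word_map A B C (1, 0)) + s * snd (word_map A B C (0, 1))).
Proof. unfold word_map, chord_flip; simpl; f_equal; ring. Qed.

Lemma closed_word_fixed (A B C : pt) (x : R) : closed_word A B C x ->
  exists m, word_map A B C (cos (PI * x), sin (PI * x))
            = (m * cos (PI * x), m * sin (PI * x)).
Proof.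
intros (x1 & x2 & x3 & x4 & H0 & H1 & H2 & H3 & H4).
destruct (chord_flip_form _ _ _ 1 H0) as [m0 E0].
destruct (chord_flip_form _ _ _ m0 H1) as [m1 E1].
destruct (chord_flip_form _ _ _ m1 H2) as [m2 E2].
destruct (chord_flip_form _ _ _ m2 H3) as [m3 E3].
destruct (chord_flip_form _ _ _ m3 H4) as [m4 E4].
destruct (cos_sin_PI_shift2 x) as [Hc Hs]; rewrite Hc, Hs in E4.
exists m4; rewrite !Rmult_1_l in E0.
unfold word_map; now rewrite E0, E1, E2, E3.
Qed.

(* A product of two half-turns is never elliptic, so its square is not a
   half-turn; this is the resulting trace obstruction. *)
Lemma word_map_not_scalar (A B C : pt) :
  in_D A -> in_D B -> in_D C ->
  snd (word_map A B C (1, 0)) = 0 -> fst (word_map A B C (0, 1)) = 0 ->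
  fst (word_map A B C (1, 0)) = snd (word_map A B C (0, 1)) -> False.
Proof.
unfold in_D; intros HA HB HC H21 H12 H11.
set (dA := 1 - fst A * fst A - snd A * snd A).
set (dB := 1 - fst B * fst B - snd B * snd B).
set (dC := 1 - fst C * fst C - snd C * snd C).
set (g := 1 - fst A * fst B - snd A * snd B).
(* The left side is the trace of [word_map] composed with the flip at [C]. That flip squares to
   [- dC], leaving the trace of the squared product of the flips at [B] and [A]. For a scalar
   [word_map] the left side is a multiple of the trace of one flip, which is 0. *)
assert (Htr : fst (word_map A B C (1, 0)) * snd C
  + fst (word_map A B C (0, 1)) * (1 - fst C)
  - snd (word_map A B C (1, 0)) * (1 + fst C)
  - snd (word_map A B C (0, 1)) * snd C
  = - dC * (4 * (g * g) - 2 * (dA * dB))).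
{ unfold word_map, chord_flip, dA, dB, dC, g; simpl; ring. }
rewrite H21, H12, H11 in Htr.
assert (HdA : 0 < dA) by (unfold dA; lra).
assert (HdB : 0 < dB) by (unfold dB; lra).
assert (HdC : 0 < dC) by (unfold dC; lra).
(* Reversed Cauchy-Schwarz for the Lorentz form: by Lagrange's identity the difference is
   [(p * p + q * q) * dA] plus the square of the inner product of [A - B] and [A]. *)
assert (Hg : dA * dB <= g * g).
{ assert (E : g * g - dA * dB =
    (fst A - fst B) * (fst A - fst B) + (snd A - snd B) * (snd A - snd B)
    - (fst A * snd B - snd A * fst B) * (fst A * snd B - snd A * fst B))
    by (unfold g, dA, dB; ring).
  set (p := fst A - fst B) in *; set (q := snd A - snd B) in *.
  replace (fst A * snd B - snd A * fst B) with (p * snd A - q * fst A) in E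
    by (unfold p, q; ring).
  assert (0 <= (p * fst A + q * snd A) * (p * fst A + q * snd A))
    by apply Rle_0_sqr.
  assert (0 <= (p * p + q * q) * dA).
  { apply Rmult_le_pos; [apply Rplus_le_le_0_compat; apply Rle_0_sqr | lra]. }
  unfold dA in *; nra. }
assert (0 < dA * dB) by (apply Rmult_lt_0_compat; trivial).
assert (0 < dC * (4 * (g * g) - 2 * (dA * dB)))
  by (apply Rmult_lt_0_compat; lra).
lra.
Qed.

(** Vandermonde in homogeneous coordinates: [K] is the determinant of the linear system in [a], [b],
    [d], and [Ka], [Kb], [Kd] are Cramer's rule. *)
Lemma quadratic_three_zeros (a b d c1 s1 c2 s2 c3 s3 : R) :
  a * c1 * c1 + b * c1 * s1 + d * s1 * s1 = 0 ->
  a * c2 * c2 + b * c2 * s2 + d * s2 * s2 = 0 ->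
  a * c3 * c3 + b * c3 * s3 + d * s3 * s3 = 0 ->
  c1 * s2 - s1 * c2 <> 0 -> c1 * s3 - s1 * c3 <> 0 ->
  c2 * s3 - s2 * c3 <> 0 -> a = 0 /\ b = 0 /\ d = 0.
Proof.
intros H1 H2 H3 D12 D13 D23.
set (K := (c1 * s2 - s1 * c2) * (c1 * s3 - s1 * c3) * (c2 * s3 - s2 * c3)).
assert (HK : K <> 0) by (unfold K; repeat apply Rmult_integral_contrapositive_currified; trivial).
set (q1 := a * c1 * c1 + b * c1 * s1 + d * s1 * s1) in *.
set (q2 := a * c2 * c2 + b * c2 * s2 + d * s2 * s2) in *.
set (q3 := a * c3 * c3 + b * c3 * s3 + d * s3 * s3) in *.
assert (Ka : K * a = q1 * (s2 * s3 * (c2 * s3 - s2 * c3))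
   - q2 * (s1 * s3 * (c1 * s3 - s1 * c3)) + q3 * (s1 * s2 * (c1 * s2 - s1 * c2)))
  by (unfold K, q1, q2, q3; ring).
assert (Kd : K * d = q1 * (c2 * c3 * (c2 * s3 - s2 * c3))
   - q2 * (c1 * c3 * (c1 * s3 - s1 * c3)) + q3 * (c1 * c2 * (c1 * s2 - s1 * c2)))
  by (unfold K, q1, q2, q3; ring).
assert (Kb : K * b = - (q1 * ((c2 * s3 + s2 * c3) * (c2 * s3 - s2 * c3))
   - q2 * ((c1 * s3 + s1 * c3) * (c1 * s3 - s1 * c3))
   + q3 * ((c1 * s2 + s1 * c2) * (c1 * s2 - s1 * c2))))
  by (unfold K, q1, q2, q3; ring).
rewrite H1, H2, H3 in Ka, Kb, Kd.
repeat split; apply (Rmult_eq_reg_l K); trivial; lra.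
Qed.

Lemma closed_word_at_most_two (A B C : pt) (x y z : R) :
  in_D A -> in_D B -> in_D C ->
  closed_word A B C x -> closed_word A B C y -> closed_word A B C z ->
  e x <> e y -> e x <> e z -> e y <> e z -> False.
Proof.
intros HA HB HC Hx Hy Hz Nxy Nxz Nyz.
rewrite e_eq_sin, Rmult_minus_distr_l, sin_minus in Nxy, Nxz, Nyz.
(* Coefficients of the determinant of a vector and its image under [word_map]: its zeros are the
   eigendirections, and it vanishes identically only for a scalar matrix. *)
set (a := snd (word_map A B C (1, 0))).
set (b := snd (word_map A B C (0, 1)) - fst (word_map A B C (1, 0))).
set (d := - fst (word_map A B C (0, 1))).
assert (Q : forall t, closed_word A B C t ->
  a * cos (PI * t) * cos (PI * t) + b * cos (PI * t) * sin (PI * t)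
  + d * sin (PI * t) * sin (PI * t) = 0).
{ intros t Ht; destruct (closed_word_fixed _ _ _ _ Ht) as [m Hm].
  rewrite word_map_linear in Hm; apply pair_equal_spec in Hm as [E1 E2].
  unfold a, b, d.
  transitivity (cos (PI * t) * (m * sin (PI * t))
                - sin (PI * t) * (m * cos (PI * t))); [| ring].
  rewrite <- E1, <- E2; ring. }
destruct (quadratic_three_zeros a b d _ _ _ _ _ _ (Q x Hx) (Q y Hy) (Q z Hz))
  as (Ea & Eb & Ed); try lra.
apply (word_map_not_scalar A B C); trivial; unfold b, d in *; lra.
Qed.

(** * Words of pentagrams *)

(* The points maximizing three positively spanning directions, taken in
   counterclockwise order, are themselves in counterclockwise order. *)
Lemma support_orientation (X Y Z : pt) (t0 t1 t2 : R) :
  0 < sin (t1 - t0) -> 0 < sin (t2 - t1) -> 0 < sin (t0 - t2) ->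
  (forall P, P = X \/ P = Y \/ P = Z ->
     fst P * cos t0 + snd P * sin t0 <= fst X * cos t0 + snd X * sin t0 /\
     fst P * cos t1 + snd P * sin t1 <= fst Y * cos t1 + snd Y * sin t1 /\
     fst P * cos t2 + snd P * sin t2 <= fst Z * cos t2 + snd Z * sin t2) ->
  0 <= cross3 X Y Z.
Proof.
intros S01 S12 S20 H.
destruct (H X) as (_ & X1 & X2); [tauto |].
destruct (H Y) as (Y0 & _ & Y2); [tauto |].
destruct (H Z) as (Z0 & Z1 & _); [tauto |].
clear H.
(* A positive linear relation between the three normals, which turns the inequalities along the
   third into ones along the first two. *)
assert (R1 : forall u v, sin (t2 - t1) * (u * cos t0 + v * sin t0)
  + sin (t0 - t2) * (u * cos t1 + v * sin t1)
  + sin (t1 - t0) * (u * cos t2 + v * sin t2) = 0).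
{ intros u v; rewrite !sin_minus; ring. }
set (u1 := fst Y - fst X); set (u2 := snd Y - snd X).
set (w1 := fst Z - fst Y); set (w2 := snd Z - snd Y).
set (a := - (u1 * cos t0 + u2 * sin t0)).
set (a1 := u1 * cos t1 + u2 * sin t1).
set (b := w1 * cos t0 + w2 * sin t0).
set (b1 := - (w1 * cos t1 + w2 * sin t1)).
assert (D : cross3 X Y Z * sin (t1 - t0) = a * b1 - a1 * b).
{ unfold cross3, a, a1, b, b1, u1, u2, w1, w2; rewrite sin_minus; ring. }
pose proof (R1 w1 w2) as Rw; pose proof (R1 (u1 + w1) (u2 + w2)) as Ru.
set (l := sin (t2 - t1)) in *; set (m := sin (t0 - t2)) in *.
set (n := sin (t1 - t0)) in *.
assert (Ha : 0 <= a) by (unfold a, u1, u2; lra).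
assert (Ha1 : 0 <= a1) by (unfold a1, u1, u2; lra).
assert (Hb1 : 0 <= b1) by (unfold b1, w1, w2; lra).
assert (Hb : b <= a) by (unfold a, b, u1, u2, w1, w2; lra).
assert (Hw : l * b <= m * b1).
{ assert (0 <= n * (w1 * cos t2 + w2 * sin t2))
    by (apply Rmult_le_pos; unfold w1, w2; lra).
  unfold b, b1; lra. }
assert (Hu : m * a1 <= m * b1 + l * (a - b)).
{ assert (0 <= n * ((u1 + w1) * cos t2 + (u2 + w2) * sin t2))
    by (apply Rmult_le_pos; unfold u1, u2, w1, w2; lra).
  unfold a, a1, b, b1; lra. }
(* By [D] this is the claim. For [b > 0] it is [Hu] times [b] combined with [Hw] times [a - b]. *)
assert (Hgoal : a1 * b <= a * b1).
{ destruct (Rle_dec b 0) as [Hb0 | Hb0].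
  - assert (0 <= a1 * - b) by (apply Rmult_le_pos; lra).
    assert (0 <= a * b1) by (apply Rmult_le_pos; lra). lra.
  - apply (Rmult_le_reg_l m); trivial.
    assert (m * a1 * b <= (m * b1 + l * (a - b)) * b)
      by (apply Rmult_le_compat_r; lra).
    assert ((a - b) * (l * b) <= (a - b) * (m * b1))
      by (apply Rmult_le_compat_l; lra).
    lra. }
apply (Rmult_le_reg_r n); [trivial | lra].
Qed.

Inductive vertex := VA | VB | VC.

Definition vertex_pt (A B C : pt) (i : vertex) : pt :=
  match i with VA => A | VB => B | VC => C end.

Definition succ_vertex (i : vertex) : vertex :=
  match i with VA => VB | VB => VC | VC => VA end.

(* The conclusion says that some cyclic rotation of the word has the form
   i, i+1, i+2, i+1, i+2. *)
Lemma cyclic_word_classes (l0 l1 l2 l3 l4 : vertex) :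
  l0 <> l1 -> l1 <> l2 -> l2 <> l3 -> l3 <> l4 -> l4 <> l0 ->
  (l0 <> l2 -> l1 = succ_vertex l0) -> (l1 <> l3 -> l2 = succ_vertex l1) ->
  (l2 <> l4 -> l3 = succ_vertex l2) -> (l3 <> l0 -> l4 = succ_vertex l3) ->
  (l4 <> l1 -> l0 = succ_vertex l4) ->
  let w a b c d f := b = succ_vertex a /\ c = succ_vertex b /\
                     d = b /\ f = c in
  w l0 l1 l2 l3 l4 \/ w l1 l2 l3 l4 l0 \/ w l2 l3 l4 l0 l1 \/
  w l3 l4 l0 l1 l2 \/ w l4 l0 l1 l2 l3.
Proof.
intros N0 N1 N2 N3 N4 T0 T1 T2 T3 T4 w; unfold w; clear w.
destruct l0, l1; try (now destruct N0); destruct l2; try (now destruct N1);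
destruct l3; try (now destruct N2); destruct l4; try (now destruct N3);
try (now destruct N4); simpl in *;
first [ intuition discriminate
      | exfalso;
        first [ assert (H := T0 ltac:(discriminate)); discriminate
              | assert (H := T1 ltac:(discriminate)); discriminate
              | assert (H := T2 ltac:(discriminate)); discriminate
              | assert (H := T3 ltac:(discriminate)); discriminate
              | assert (H := T4 ltac:(discriminate)); discriminate ] ].
Qed.

(** Cyclic permutations keep the signed area and transpositions negate it. *)
Lemma cross3_distinct_vertices (A B C : pt) (i j k : vertex) :
  0 < cross3 A B C -> i <> j -> j <> k -> i <> k ->
  0 <= cross3 (vertex_pt A B C i) (vertex_pt A B C j) (vertex_pt A B C k) ->
  j = succ_vertex i.
Proof.
unfold cross3; intros H Nij Njk Nik Hc.
destruct i, j; try (now destruct Nij); destruct k; try (now destruct Njk);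
  try (now destruct Nik); simpl in *; trivial; exfalso; lra.
Qed.

(** An orbit lifted to the line and continued past five terms, so that order and winding become
    inequalities and indices need no reduction modulo 5. [tp_no2] is what remains of the minimality
    of the period. *)
Record tangent_pentagram (A B C : pt) (X : nat -> R) : Prop := {
  tp_step : forall n, X n < X (S n) < X n + 1;
  tp_close : forall n, X (5 + n)%nat = X n + 2;
  tp_no2 : forall n, X (2 + n)%nat <> X n + 1;
  tp_left : forall n i, 0 <= chord_form (vertex_pt A B C i) (X n) (X (S n));
  tp_touch : forall n, exists i,
    chord_form (vertex_pt A B C i) (X n) (X (S n)) = 0 }.

Section Pentagram.

Context (A B C : pt) (X : nat -> R).
Context (hA : in_D A) (hB : in_D B) (hC : in_D C).
Context (hX : tangent_pentagram A B C X).

Let V := vertex_pt A B C.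

Let touches n i := chord_form (V i) (X n) (X (S n)) = 0.

Lemma in_D_vertex (i : vertex) : in_D (V i).
Proof. now destruct i. Qed.

(** The next chord keeps the vertex touched by the present one on its left, so by [chord_form_next]
    two steps cannot pass a full turn; [tp_no2] makes this strict. *)
Lemma pentagram_two_steps (n : nat) : X (2 + n)%nat < X n + 1.
Proof.
destruct (tp_touch _ _ _ _ hX n) as [i Hi].
pose proof (tp_step _ _ _ _ hX n) as H0.
pose proof (tp_step _ _ _ _ hX (S n)) as H1.
pose proof (tp_left _ _ _ _ hX (S n) i) as Hl.
pose proof (tp_no2 _ _ _ _ hX n) as Hn; simpl in *.
pose proof (chord_form_next _ _ _ (X (S (S n))) Hi) as E.
pose proof (chord_form_self_pos _ (X (S n)) (in_D_vertex i)) as Hp.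
assert (Hs : 0 < sin (PI * (X (S n) - X n))) by (apply sin_PI_pos; lra).
assert (X (S (S n)) - X n <= 1); [| lra].
apply sin_PI_nonneg_lt2; [lra |].
apply (Rmult_le_reg_r (chord_form (V i) (X (S n)) (X (S n)))); trivial.
rewrite Rmult_0_l; unfold V; rewrite <- E; apply Rmult_le_pos; lra.
Qed.

Lemma pentagram_adjacent (n : nat) (i j : vertex) :
  touches n i -> touches (S n) j -> i <> j.
Proof.
unfold touches; intros Hi Hj <-.
pose proof (pentagram_two_steps n) as H2; simpl in H2.
pose proof (tp_step _ _ _ _ hX n) as H0.
pose proof (tp_step _ _ _ _ hX (S n)) as H1.
pose proof (chord_form_next _ _ _ (X (S (S n))) Hi) as E.
rewrite Hj, Rmult_0_r in E.
pose proof (chord_form_self_pos _ (X (S n)) (in_D_vertex i)) as Hp.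
assert (0 < sin (PI * (X (S (S n)) - X n))) by (apply sin_PI_pos; lra).
assert (0 < sin (PI * (X (S (S n)) - X n)) * chord_form (V i) (X (S n)) (X (S n)))
  by (apply Rmult_lt_0_compat; trivial).
lra.
Qed.

Lemma touches_support (n : nat) (i k : vertex) : touches n i ->
  let t := PI * (X n + X (S n)) in
  fst (V k) * cos t + snd (V k) * sin t <= fst (V i) * cos t + snd (V i) * sin t.
Proof.
intros Hi t; pose proof (tp_left _ _ _ _ hX n k) as Hk; fold V in Hk.
unfold touches in Hi; rewrite chord_form_angle in Hi, Hk; fold t in Hi, Hk.
lra.
Qed.

Lemma pentagram_triple (n : nat) (i j k : vertex) :
  touches n i -> touches (S n) j -> touches (S (S n)) k ->
  0 <= cross3 (V i) (V j) (V k).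
Proof.
intros Hi Hj Hk.
pose proof (pentagram_two_steps n) as D0.
pose proof (pentagram_two_steps (S n)) as D1.
pose proof (pentagram_two_steps (3 + n)) as D3.
pose proof (tp_close _ _ _ _ hX n) as E; simpl in *.
pose proof (tp_step _ _ _ _ hX n).
pose proof (tp_step _ _ _ _ hX (S n)).
pose proof (tp_step _ _ _ _ hX (S (S n))).
apply (support_orientation _ _ _ (PI * (X n + X (S n)))
  (PI * (X (S n) + X (S (S n)))) (PI * (X (S (S n)) + X (S (S (S n)))))).
- rewrite <- Rmult_minus_distr_l; apply sin_PI_pos; lra.
- rewrite <- Rmult_minus_distr_l; apply sin_PI_pos; lra.
(* This gap closes up only after adding a full turn; [D3] and [E] give [X n + 1 < X (n + 3)], which
   keeps it below [PI]. *)
- rewrite <- Rmult_minus_distr_l.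
  rewrite <- (proj2 (cos_sin_PI_shift2 _)); apply sin_PI_pos; lra.
- intros P HP.
  assert (exists m, P = V m) as [m ->]
    by (destruct HP as [-> | [-> | ->]]; eexists; reflexivity).
  repeat split; now apply touches_support.
Qed.

Lemma touches_shift (n : nat) (i : vertex) : touches n i -> touches (5 + n) i.
Proof.
unfold touches; intros H.
replace (S (5 + n)) with (5 + S n)%nat by lia.
now rewrite !(tp_close _ _ _ _ hX), chord_form_shift2.
Qed.

Lemma pentagram_closed_word : 0 < cross3 A B C ->
  exists n i, closed_word (V (succ_vertex i)) (V (succ_vertex (succ_vertex i)))
                          (V i) (X n).
Proof.
intros Hor.
destruct (tp_touch _ _ _ _ hX 0) as [l0 H0].
destruct (tp_touch _ _ _ _ hX 1) as [l1 H1].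
destruct (tp_touch _ _ _ _ hX 2) as [l2 H2].
destruct (tp_touch _ _ _ _ hX 3) as [l3 H3].
destruct (tp_touch _ _ _ _ hX 4) as [l4 H4].
fold V in H0, H1, H2, H3, H4.
fold (touches 0 l0) in H0; fold (touches 1 l1) in H1; fold (touches 2 l2) in H2.
fold (touches 3 l3) in H3; fold (touches 4 l4) in H4.
(* Touches beyond index 4 let a rotated word be read from its own starting index. *)
pose proof (touches_shift 0 _ H0) as H5; pose proof (touches_shift 1 _ H1) as H6.
pose proof (touches_shift 2 _ H2) as H7; pose proof (touches_shift 3 _ H3) as H8.
simpl in H5, H6, H7, H8.
assert (T : forall n i j k, touches n i -> touches (S n) j ->
  touches (S (S n)) k -> i <> k -> j = succ_vertex i).
{ intros n i j k Hi Hj Hk Nik.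
  apply (cross3_distinct_vertices A B C i j k); trivial.
  - exact (pentagram_adjacent _ _ _ Hi Hj).
  - exact (pentagram_adjacent _ _ _ Hj Hk).
  - exact (pentagram_triple _ _ _ _ Hi Hj Hk). }
assert (W : forall n i j k, j = succ_vertex i -> k = succ_vertex j ->
  touches n i -> touches (1 + n) j -> touches (2 + n) k ->
  touches (3 + n) j -> touches (4 + n) k ->
  closed_word (V (succ_vertex i)) (V (succ_vertex (succ_vertex i))) (V i) (X n)).
{ intros n i j k -> -> W0 W1 W2 W3 W4.
  exists (X (1 + n)%nat), (X (2 + n)%nat), (X (3 + n)%nat), (X (4 + n)%nat).
  rewrite <- (tp_close _ _ _ _ hX); repeat split; assumption. }
destruct (cyclic_word_classes l0 l1 l2 l3 l4) as
  [(-> & -> & -> & ->) | [(-> & -> & -> & ->) | [(-> & -> & -> & ->) |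
  [(-> & -> & -> & ->) | (-> & -> & -> & ->)]]]];
  eauto using pentagram_adjacent.
Qed.

End Pentagram.

(** * The tangent map of a triangle *)

(** Seen from [v] the disk lies in an open half-plane, where [d > 0], so the angular order of the
    vertices is total and transitive and has a least element. *)
Lemma cross3_rightmost (v P1 P2 P3 : pt) :
  on_S1 v -> in_D P1 -> in_D P2 -> in_D P3 ->
  exists P, (P = P1 \/ P = P2 \/ P = P3) /\
    0 <= cross3 v P P1 /\ 0 <= cross3 v P P2 /\ 0 <= cross3 v P P3.
Proof.
intros Hv H1 H2 H3.
set (d := fun P : pt => fst v * (fst v - fst P) + snd v * (snd v - snd P)).
assert (Hd : forall P, in_D P -> 0 < d P).
{ unfold d, in_D, on_S1 in *; intros P HP.
  pose proof (Rle_0_sqr (fst v - fst P)); pose proof (Rle_0_sqr (snd v - snd P)).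
  unfold Rsqr in *; lra. }
pose proof (Hd _ H1) as d1; pose proof (Hd _ H2) as d2; pose proof (Hd _ H3) as d3.
assert (Ha : forall P Q, cross3 v P Q = - cross3 v Q P)
  by (intros; unfold cross3; ring).
assert (Hs : forall P, cross3 v P P = 0) by (intros; unfold cross3; ring).
assert (Ht : forall P Q S, 0 < d P -> 0 < d Q -> 0 < d S ->
  0 <= cross3 v P Q -> 0 <= cross3 v Q S -> 0 <= cross3 v P S).
{ intros P Q S dP dQ dS HPQ HQS.
  apply (Rmult_le_reg_r (d Q)); trivial.
  replace (cross3 v P S * d Q) with (cross3 v P Q * d S + cross3 v Q S * d P)
    by (unfold cross3, d; ring).
  rewrite Rmult_0_l.
  apply Rplus_le_le_0_compat; apply Rmult_le_pos; lra. }
assert (Htot : forall P Q, 0 <= cross3 v P Q \/ 0 <= cross3 v Q P).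
{ intros P Q; rewrite (Ha Q P); lra. }
pose proof (Hs P1); pose proof (Hs P2); pose proof (Hs P3).
destruct (Htot P1 P2) as [E12 | E21].
- destruct (Htot P1 P3) as [E13 | E31].
  + exists P1; repeat split; [tauto | lra | lra | lra].
  + exists P3; repeat split; [tauto | lra | | lra]; now apply (Ht P3 P1 P2).
- destruct (Htot P2 P3) as [E23 | E32].
  + exists P2; repeat split; [tauto | lra | lra | lra].
  + exists P3; repeat split; [tauto | | lra | lra]; now apply (Ht P3 P2 P1).
Qed.

Lemma chord_other_end (v P : pt) : on_S1 v -> in_D P ->
  exists w t, on_S1 w /\ w <> v /\ 0 < t /\
    forall Q, cross3 v w Q = t * cross3 v P Q.
Proof.
destruct v as [a b], P as [p q]; unfold on_S1, in_D; simpl; intros Hv HP.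
set (n := (p - a) * (p - a) + (q - b) * (q - b)).
set (d := a * (a - p) + b * (b - q)).
assert (Hd : 0 < d).
{ unfold d; pose proof (Rle_0_sqr (p - a)); pose proof (Rle_0_sqr (q - b)).
  unfold Rsqr in *; lra. }
assert (Hn : 0 < n).
{ assert (0 <= n) by (apply Rplus_le_le_0_compat; apply Rle_0_sqr).
  assert (n <> 0); [| lra].
  intros E; destruct (Rplus_sqr_eq_0 _ _ E); unfold d in Hd; nra. }
(* The nonzero root of [t * (t * n - 2 * d) = 0], the equation for the point at parameter [t] on the
   line from [v] through [P] to be on the circle. *)
set (t := 2 * d / n).
assert (Ht : 0 < t) by (apply Rdiv_lt_0_compat; lra).
assert (Htn : t * n = 2 * d) by (unfold t; field; lra).
exists (a + t * (p - a), b + t * (q - b)), t; repeat split; simpl; trivial.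
- replace ((a + t * (p - a)) * (a + t * (p - a))
           + (b + t * (q - b)) * (b + t * (q - b)))
    with ((a * a + b * b) + t * (t * n - 2 * d)) by (unfold n, d; ring).
  rewrite Htn, Hv; ring.
- intros E; apply pair_equal_spec in E as [E1 E2].
  assert (p - a = 0) as E3 by (apply (Rmult_eq_reg_l t); lra).
  assert (q - b = 0) as E4 by (apply (Rmult_eq_reg_l t); lra).
  unfold n in Hn; rewrite E3, E4 in Hn; lra.
- intros Q; unfold cross3; simpl; ring.
Qed.

Lemma cross3_barycenter (v w P1 P2 P3 p : pt) (a b c : R) : a + b + c = 1 ->
  fst p = a * fst P1 + b * fst P2 + c * fst P3 ->
  snd p = a * snd P1 + b * snd P2 + c * snd P3 ->
  cross3 v w p = a * cross3 v w P1 + b * cross3 v w P2 + c * cross3 v w P3.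
Proof.
intros H E1 E2; unfold cross3; rewrite E1, E2.
replace c with (1 - a - b) by lra; ring.
Qed.

Lemma filled_triangle_vertices (P1 P2 P3 P : pt) :
  P = P1 \/ P = P2 \/ P = P3 -> filled_triangle P1 P2 P3 P.
Proof.
intros [-> | [-> | ->]]; [exists 1, 0, 0 | exists 0, 1, 0 | exists 0, 0, 1];
  repeat split; lra.
Qed.

(** As [psi] is chosen by [epsilon], a value must be exhibited: the far end of the chord through the
    rightmost vertex. *)
Lemma psi_triangle_spec (P1 P2 P3 v : pt) :
  on_S1 v -> in_D P1 -> in_D P2 -> in_D P3 ->
  psi_rel (filled_triangle P1 P2 P3) v (psi (filled_triangle P1 P2 P3) v).
Proof.
intros Hv H1 H2 H3; unfold psi; apply epsilon_spec.
destruct (cross3_rightmost v P1 P2 P3) as (P & HP & L1 & L2 & L3); trivial.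
assert (HD : in_D P) by (destruct HP as [-> | [-> | ->]]; trivial).
destruct (chord_other_end v P) as (w & t & Hw & Hwv & Ht & Hc); trivial.
exists w; repeat split; trivial.
- exists P; split; [now apply filled_triangle_vertices |].
  rewrite Hc; unfold cross3; ring.
- intros p (a & b & c & Ha & Hb & Hcc & Hs & E1 & E2).
  rewrite (cross3_barycenter _ _ _ _ _ _ _ _ _ Hs E1 E2), !Hc.
  repeat apply Rplus_le_le_0_compat; repeat apply Rmult_le_pos; lra.
Qed.

(** A convex combination of nonnegative numbers vanishes only if a term of positive weight does, so
    contact with the triangle occurs at a vertex. *)
Lemma psi_rel_triangle (P1 P2 P3 v w : pt) :
  psi_rel (filled_triangle P1 P2 P3) v w ->
  (0 <= cross3 v w P1 /\ 0 <= cross3 v w P2 /\ 0 <= cross3 v w P3) /\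
  (cross3 v w P1 = 0 \/ cross3 v w P2 = 0 \/ cross3 v w P3 = 0).
Proof.
intros (_ & _ & (p & (a & b & c & Ha & Hb & Hc & Hs & E1 & E2) & Hp) & Hl).
assert (L1 := Hl P1 ltac:(apply filled_triangle_vertices; tauto)).
assert (L2 := Hl P2 ltac:(apply filled_triangle_vertices; tauto)).
assert (L3 := Hl P3 ltac:(apply filled_triangle_vertices; tauto)).
split; [tauto |].
rewrite (cross3_barycenter _ _ _ _ _ _ _ _ _ Hs E1 E2) in Hp.
assert (M1 := Rmult_le_pos _ _ Ha L1).
assert (M2 := Rmult_le_pos _ _ Hb L2).
assert (M3 := Rmult_le_pos _ _ Hc L3).
assert (Z1 : a * cross3 v w P1 = 0) by lra.
assert (Z2 : b * cross3 v w P2 = 0) by lra.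
assert (Z3 : c * cross3 v w P3 = 0) by lra.
apply Rmult_integral in Z1, Z2, Z3.
destruct Z1, Z2, Z3; auto; lra.
Qed.

(** * Lifts and periodic orbits *)

(** Without fixed points [F t - t] never meets an integer, so by continuity it stays in the unit
    interval that contains [F 0]. *)
Lemma lift_between (f : pt -> pt) (F : R -> R) :
  is_lift f F -> (forall x, f (e x) <> e x) -> forall x, x < F x < x + 1.
Proof.
intros (Hc & He & H0) Hf.
assert (N : forall x (k : Z), F x <> x + IZR k).
{ intros x k E; apply (Hf x); rewrite <- He; symmetry.
  apply e_eq; now exists k. }
assert (I : forall (k : Z) x, 0 < (F 0 - 0 - IZR k) * (F x - x - IZR k)).
{ intros k x; apply Rnot_le_lt; intros Hle.
  set (g := fun t => F t - t - IZR k).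
  assert (Hg : continuity g).
  { apply continuity_minus; [apply continuity_minus |]; trivial.
    - apply derivable_continuous, derivable_id.
    - apply continuity_const; now intros ? ?. }
  assert (exists z, g z = 0) as [z Hz].
  { destruct (Rle_dec 0 x) as [Hx | Hx].
    - destruct (IVT_cor g 0 x) as [z [_ Hz]]; eauto.
    - destruct (IVT_cor g x 0) as [z [_ Hz]]; eauto; [lra |].
      rewrite Rmult_comm; exact Hle. }
  apply (N z k); unfold g in Hz; lra. }
intros x; pose proof (N 0 0%Z) as N0; simpl in N0.
pose proof (I 0%Z x) as I0; pose proof (I 1%Z x) as I1; simpl in I0, I1.
split; nra.
Qed.

(** Equivariance is absent from [is_lift]; it follows since both sides differ by an integer that the
    bounds force to be 0. *)
Lemma lift_shift (f : pt -> pt) (F : R -> R) (x : R) (k : Z) :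
  (forall t, e (F t) = f (e t)) -> (forall t, t < F t < t + 1) ->
  F (x + IZR k) = F x + IZR k.
Proof.
intros He Hb.
assert (E : e (F x) = e (F (x + IZR k))).
{ rewrite !He; f_equal; apply e_eq; now exists k. }
apply e_eq in E as [j Hj].
pose proof (Hb x) as B0; pose proof (Hb (x + IZR k)) as B1.
assert (j = k) as <-; [| exact Hj].
assert (-1 < j - k < 1)%Z; [| lia].
split; apply lt_IZR; rewrite minus_IZR; lra.
Qed.

Lemma iter_lift_shift (F : R -> R) (k : Z) (n : nat) (x : R) :
  (forall t, F (t + IZR k) = F t + IZR k) ->
  Nat.iter n F (x + IZR k) = Nat.iter n F x + IZR k.
Proof.
intros H; induction n as [| n IH]; [reflexivity |].
rewrite !Nat.iter_succ, IH; apply H.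
Qed.

Lemma iter_lift_e (f : pt -> pt) (F : R -> R) (n : nat) (x : R) :
  (forall t, e (F t) = f (e t)) -> Nat.iter n f (e x) = e (Nat.iter n F x).
Proof.
intros H; induction n as [| n IH]; [reflexivity |].
now rewrite !Nat.iter_succ, IH, H.
Qed.

Lemma iter_mul_fixed {T : Type} (f : T -> T) (p n : nat) (v : T) :
  Nat.iter p f v = v -> Nat.iter (n * p) f v = v.
Proof.
intros H; induction n as [| n IH]; [reflexivity |].
simpl Nat.mul; now rewrite Nat.iter_add, IH.
Qed.

(** Along multiples of [p] the averages are constantly [IZR k / INR p], so the limit can only be
    this value. *)
Lemma rotation_period (F : R -> R) (x r : R) (p : nat) (k : Z) :
  (0 < p)%nat -> (forall t, F (t + IZR k) = F t + IZR k) ->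
  Nat.iter p F x = x + IZR k ->
  Un_cv (fun n => (Nat.iter n F x - x) / INR n) r -> IZR k = r * INR p.
Proof.
intros Hp Hs Hk Hcv.
assert (HI : forall n, Nat.iter (n * p) F x = x + INR n * IZR k).
{ induction n as [| n IH]; [simpl; ring |].
  replace (S n * p)%nat with (n * p + p)%nat by lia.
  rewrite Nat.iter_add, Hk, iter_lift_shift, IH, S_INR by trivial; ring. }
assert (Hp' : 0 < INR p) by (apply lt_0_INR; lia).
destruct (Req_dec (IZR k / INR p) r) as [<- | Hne]; [field; lra |].
exfalso.
destruct (Hcv (Rabs (IZR k / INR p - r))) as [N HN].
{ apply Rabs_pos_lt; lra. }
assert (HSN : 0 < INR (S N)) by (apply lt_0_INR; lia).
specialize (HN (S N * p)%nat); unfold Rdist in HN.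
rewrite HI, mult_INR in HN.
replace ((x + INR (S N) * IZR k - x) / (INR (S N) * INR p))
  with (IZR k / INR p) in HN by (field; lra).
assert (S N * p >= N)%nat by nia.
specialize (HN H); lra.
Qed.

Lemma same_orbit_meet (f : pt -> pt) (p : nat) (u v w : pt) : (0 < p)%nat ->
  Nat.iter p f v = v -> same_orbit f u w -> same_orbit f v w ->
  same_orbit f u v.
Proof.
intros Hp Hv [m Hm] [n Hn].
(* [m] steps lead from [u] to [w], which is [n] steps past [v]; the rest completes [n] periods of
   [v]. *)
exists ((n * p - n) + m)%nat.
rewrite Nat.iter_add, Hm, <- Hn, <- Nat.iter_add.
replace (n * p - n + n)%nat with (n * p)%nat by nia.
now apply iter_mul_fixed.
Qed.

Lemma ForallOrdPairs_split {T : Type} (R : T -> T -> Prop) (P Q : T -> Prop)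
    (l : list T) :
  (forall v, In v l -> P v \/ Q v) -> ForallOrdPairs R l ->
  exists l1 l2, length l = (length l1 + length l2)%nat /\
    (forall v, In v l1 -> In v l /\ P v) /\ (forall v, In v l2 -> In v l /\ Q v) /\
    ForallOrdPairs R l1 /\ ForallOrdPairs R l2.
Proof.
intros H HR; induction HR as [| a l Ha HR IH].
- exists nil, nil; repeat split; try constructor; contradiction.
- destruct IH as (l1 & l2 & E & I1 & I2 & R1 & R2);
    [intros; apply H; now right |].
  assert (HF : forall l' (W : T -> Prop), (forall v, In v l' -> In v l /\ W v) ->
    Forall (R a) l').
  { intros l' W Hl; apply Forall_forall; intros v Hv.
    rewrite Forall_forall in Ha; apply Ha, (Hl v Hv). }
  destruct (H a (or_introl eq_refl)) as [Pa | Qa].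
  + exists (a :: l1), l2; repeat split; simpl; try lia; trivial.
    * destruct H0 as [<- | Hv]; [now left | right; now apply I1].
    * destruct H0 as [<- | Hv]; [trivial | now apply I1].
    * right; now apply I2.
    * now apply I2.
    * constructor; eauto.
  + exists l1, (a :: l2); repeat split; simpl; try lia; trivial.
    * right; now apply I1.
    * now apply I1.
    * destruct H0 as [<- | Hv]; [now left | right; now apply I2].
    * destruct H0 as [<- | Hv]; [trivial | now apply I2].
    * constructor; eauto.
Qed.

(** * From period-5 points to pentagrams, and the count of orbits *)

Lemma lift_pentagram (A B C : pt) (f : pt -> pt) (F : R -> R) (x : R) :
  (forall t, e (F t) = f (e t)) -> (forall t, t < F t < t + 1) ->
  (forall t i, 0 <= chord_form (vertex_pt A B C i) t (F t)) ->
  (forall t, exists i, chord_form (vertex_pt A B C i) t (F t) = 0) ->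
  Un_cv (fun n => (Nat.iter n F x - x) / INR n) (2 / 5) ->
  periodic_pt f 5 (e x) ->
  tangent_pentagram A B C (fun n => Nat.iter n F x).
Proof.
intros He Hb Hl Ht Hcv (_ & H5 & Hmin).
assert (Hs : forall (k : Z) t, F (t + IZR k) = F t + IZR k)
  by (intros; now apply (lift_shift f)).
pose proof H5 as E5; rewrite (iter_lift_e _ F) in E5 by trivial.
symmetry in E5; apply e_eq in E5 as [k Hk].
pose proof (rotation_period F x (2 / 5) 5 k ltac:(lia) (Hs k) Hk Hcv) as Hk2.
assert (k = 2%Z) as -> by (apply eq_IZR; rewrite Hk2; simpl; lra).
constructor.
- intros n; apply Hb.
- intros n; rewrite Nat.add_comm, Nat.iter_add, Hk.
  apply (iter_lift_shift F 2), Hs.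
(* A coincidence at index [n] is carried by [n * 4] further iterates to index [n * 5], which is the
   starting point again. *)
- intros n E; apply (Hmin 2%nat); [lia |].
  rewrite <- (iter_mul_fixed f 5 n (e x) H5) at 1.
  rewrite <- Nat.iter_add.
  replace (2 + n * 5)%nat with (n * 4 + (2 + n))%nat by lia.
  rewrite Nat.iter_add, (iter_lift_e f F (2 + n)), E by trivial.
  replace (e (Nat.iter n F x + 1)) with (e (Nat.iter n F x))
    by (apply e_eq; now exists 1%Z).
  rewrite <- (iter_lift_e f F), <- Nat.iter_add by trivial.
  replace (n * 4 + n)%nat with (n * 5)%nat by lia.
  now apply iter_mul_fixed.
- intros n i; apply Hl.
- intros n; apply Ht.
Qed.

Lemma period5_orbits_le6 (A B C : pt) (f : pt -> pt) (F : R -> R) (l : list pt) :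
  in_D A -> in_D B -> in_D C -> 0 < cross3 A B C ->
  (forall t, e (F t) = f (e t)) -> (forall t, t < F t < t + 1) ->
  (forall t i, 0 <= chord_form (vertex_pt A B C i) t (F t)) ->
  (forall t, exists i, chord_form (vertex_pt A B C i) t (F t) = 0) ->
  (forall x, Un_cv (fun n => (Nat.iter n F x - x) / INR n) (2 / 5)) ->
  (forall v, In v l -> periodic_pt f 5 v) ->
  ForallOrdPairs (fun u v => ~ same_orbit f u v) l ->
  (length l <= 6)%nat.
Proof.
intros HA HB HC Hor He Hb Hl Ht Hcv Hper HR.
set (V := vertex_pt A B C).
(* An orbit is sorted by the vertex that begins its word; three classes of at most two orbits give
   6. *)
set (cls := fun i v => exists x, same_orbit f v (e x) /\
  closed_word (V (succ_vertex i)) (V (succ_vertex (succ_vertex i))) (V i) x).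
assert (HV : forall i, in_D (V i)) by (now intros []).
assert (Hcls : forall v, In v l -> cls VA v \/ (cls VB v \/ cls VC v)).
{ intros v Hv; pose proof (Hper v Hv) as Pv.
  destruct (on_S1_angle v (proj1 Pv)) as [x ->].
  pose proof (lift_pentagram A B C f F x He Hb Hl Ht (Hcv x) Pv) as Hp.
  destruct (pentagram_closed_word A B C _ HA HB HC Hp Hor) as (n & i & Hw).
  assert (cls i (e x)).
  { exists (Nat.iter n F x); split; [| exact Hw].
    exists n; now apply iter_lift_e. }
  destruct i; tauto. }
assert (H2 : forall i l', (forall v, In v l' -> In v l /\ cls i v) ->
  ForallOrdPairs (fun u v => ~ same_orbit f u v) l' -> (length l' <= 2)%nat).
{ intros i [| a [| b [| c l']]] Hin HR'; simpl; try lia; exfalso.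
  assert (N : ~ same_orbit f a b /\ ~ same_orbit f a c /\ ~ same_orbit f b c).
  { inversion_clear HR' as [| ? ? Fa HR1].
    inversion_clear HR1 as [| ? ? Fb _].
    rewrite Forall_forall in Fa, Fb.
    repeat split; [apply Fa | apply Fa | apply Fb]; simpl; tauto. }
  destruct N as (Nab & Nac & Nbc).
  destruct (Hin a) as (_ & x & Ox & Wx); [simpl; tauto |].
  destruct (Hin b) as (Ib & y & Oy & Wy); [simpl; tauto |].
  destruct (Hin c) as (Ic & z & Oz & Wz); [simpl; tauto |].
  pose proof (proj1 (proj2 (Hper b Ib))) as Pb.
  pose proof (proj1 (proj2 (Hper c Ic))) as Pc.
  (* Two equal starting points would make their orbits meet, hence coincide. *)
  apply (closed_word_at_most_two _ _ _ x y z (HV _) (HV _) (HV _) Wx Wy Wz);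
    intros E.
  - apply Nab, (same_orbit_meet f 5 a b (e x)); trivial; [lia | now rewrite E].
  - apply Nac, (same_orbit_meet f 5 a c (e x)); trivial; [lia | now rewrite E].
  - apply Nbc, (same_orbit_meet f 5 b c (e y)); trivial; [lia | now rewrite E]. }
destruct (ForallOrdPairs_split _ _ _ l Hcls HR) as (l1 & l' & E & I1 & I' & R1 & R').
destruct (ForallOrdPairs_split _ (cls VB) (cls VC) l'
  ltac:(intros v Hv; apply (I' v Hv)) R') as (l2 & l3 & E' & I2 & I3 & R2 & R3).
pose proof (H2 VA l1 I1 R1).
assert (length l2 <= 2)%nat.
{ apply (H2 VB); trivial; intros v Hv; destruct (I2 v Hv) as [Hv' ?].
  split; [apply (I' v Hv') | trivial]. }
assert (length l3 <= 2)%nat.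
{ apply (H2 VC); trivial; intros v Hv; destruct (I3 v Hv) as [Hv' ?].
  split; [apply (I' v Hv') | trivial]. }
lia.
Qed.

(* Any family of period-5 points lying in pairwise distinct orbits has at
   most 6 members, i.e. psi_T has at most 6 periodic orbits of period 5. *)
Theorem theorem5p2 (P1 P2 P3 : pt)
  (hP1 : in_D P1) (hP2 : in_D P2) (hP3 : in_D P3)
  (hnondeg : cross3 P1 P2 P3 <> 0)
  (hrho : rot_number (psi (filled_triangle P1 P2 P3)) (2 / 5)) :
  forall l : list pt,
    (forall v, In v l -> periodic_pt (psi (filled_triangle P1 P2 P3)) 5 v) ->
    ForallOrdPairs (fun u v => ~ same_orbit (psi (filled_triangle P1 P2 P3)) u v) l ->
    (length l <= 6)%nat.
Proof.
intros l Hper HR.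
destruct hrho as (F & HF & Hcv).
set (f := psi (filled_triangle P1 P2 P3)) in *.
assert (Hpsi : forall x, psi_rel (filled_triangle P1 P2 P3) (e x) (f (e x)))
  by (intros x; apply psi_triangle_spec; trivial; apply on_S1_e).
assert (Hb : forall x, x < F x < x + 1).
{ apply (lift_between f); trivial; intros x; apply (Hpsi x). }
destruct HF as (_ & He & _).
assert (Hchord : forall x,
  (0 <= chord_form P1 x (F x) /\ 0 <= chord_form P2 x (F x) /\
   0 <= chord_form P3 x (F x)) /\
  (chord_form P1 x (F x) = 0 \/ chord_form P2 x (F x) = 0 \/
   chord_form P3 x (F x) = 0)).
{ intros x; pose proof (psi_rel_triangle _ _ _ _ _ (Hpsi x)) as [Hl Ht].
  rewrite <- He, !cross3_chord_form in Hl, Ht.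
  assert (Hs : 0 < 2 * sin (PI * (F x - x))).
  { pose proof (Hb x); assert (0 < sin (PI * (F x - x))) by (apply sin_PI_pos; lra).
    lra. }
  set (s := 2 * sin (PI * (F x - x))) in *.
  assert (Hpos : forall c, 0 <= s * c -> 0 <= c)
    by (intros c Hc; apply (Rmult_le_reg_l s); lra).
  assert (Hzero : forall c, s * c = 0 -> c = 0)
    by (intros c Hc; apply (Rmult_eq_reg_l s); lra).
  split; [repeat split; apply Hpos; tauto |].
  destruct Ht as [Ht | [Ht | Ht]]; apply Hzero in Ht; tauto. }
destruct (Rlt_dec 0 (cross3 P1 P2 P3)) as [Hor | Hor].
- apply (period5_orbits_le6 P1 P2 P3 f F); trivial.
  + intros t []; apply (Hchord t).
  + intros t; destruct (proj2 (Hchord t)) as [? | [? | ?]];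
      [exists VA | exists VB | exists VC]; trivial.
(* A clockwise triangle becomes counterclockwise after exchanging two vertices. *)
- apply (period5_orbits_le6 P1 P3 P2 f F); trivial.
  + unfold cross3 in *; lra.
  + intros t []; apply (Hchord t).
  + intros t; destruct (proj2 (Hchord t)) as [? | [? | ?]];
      [exists VA | exists VC | exists VB]; trivial.
Qed.
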